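(* Let $f:\mathbb{R}^n\to\mathbb{R}$ be differentiable and let $g(x,\xi)$ be a stochastic gradient oracle such that for all $x\in\mathbb{R}^n$: (1) $\mathbb{E}_\xi[g(x,\xi)]=\nabla f(x)$; (2) $\mathbb{E}_\xi[\exp(\|g(x,\xi)-\nabla f(x)\|^2/\sigma^2)]\le \mathrm{e}$; (3) $\|g(x,\xi)\|_1\le B$ for all $\xi\in\Xi$. Let $r,M\in\mathbb{N}$ and $$\sigma_{r,M}^2 = 50\left(\frac{2(1-1/n)B^2}{\mathrm{e}M}+\frac{\sigma^2}{r}\right).$$ Then the PPS quantized gradient oracle with batch size $r$ and $M$ quantization samples satisfies $$\forall x\in\mathbb{R}^n,\quad \mathbb{E}_{\boldsymbol{\xi},\boldsymbol{k},\boldsymbol{l}}\left[\exp\left(\|PPS(x,\boldsymbol{\xi},\boldsymbol{k},\boldsymbol{l})-\nabla f(x)\|^2/\sigma_{r,M}^2\right)\right]\le \mathrm{e}.$$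
   Context: $\|\cdot\|$ is the Euclidean norm, $\|\cdot\|_1$ the $\ell_1$ norm, $\boldsymbol{e}_i$ the $i$th standard basis vector of $\mathbb{R}^n$. For $\boldsymbol{v}\in\mathbb{R}^n$, $[\boldsymbol{v}]_+$ is the vector with $i$th component $\max\{0,v_i\}$. PPS (probability-proportional-to-size) quantized gradient oracle: given $x$ and $\boldsymbol{\xi}=(\xi_1,\dots,\xi_r)\in\Xi^r$ with independent components, let $\boldsymbol{G}=\frac1r\sum_{i=1}^r g(x,\xi_i)$, so $\boldsymbol{G}=[\boldsymbol{G}]_+-[-\boldsymbol{G}]_+$. Let $P_{\boldsymbol{G}}$ be the categorical distribution on $\{1,\dots,n\}$ with probabilities $P_{\boldsymbol{G}}(k)=[G_k]_+/\|[\boldsymbol{G}]_+\|_1$ and $P_{-\boldsymbol{G}}$ the one with probabilities $[-G_k]_+/\|[-\boldsymbol{G}]_+\|_1$. Given $\boldsymbol{G}$, let $\boldsymbol{k},\boldsymbol{l}\in\{1,\dots,n\}^M$ have independent components drawn from $P_{\boldsymbol{G}}$ and $P_{-\boldsymbol{G}}$, respectively. Then $$PPS(x,\boldsymbol{\xi},\boldsymbol{k},\boldsymbol{l})=\frac{\|[\boldsymbol{G}]_+\|_1}{M}\sum_{i=1}^M\boldsymbol{e}_{k_i}-\frac{\|[-\boldsymbol{G}]_+\|_1}{M}\sum_{i=1}^M\boldsymbol{e}_{l_i},$$ where a term whose prefactor is $0$ is $0$. *)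

(* Defs.v *)
From HB Require Import structures.
From mathcomp Require Import all_boot all_order all_algebra.
From mathcomp Require Import all_classical all_reals all_analysis.
Import Order.TTheory GRing.Theory Num.Theory.
Import numFieldNormedType.Exports.

Set Implicit Arguments.
Unset Strict Implicit.
Unset Printing Implicit Defensive.

Local Open Scope classical_set_scope.
Local Open Scope ring_scope.

Section vectors.
Context {R : realType} {n : nat}.
Implicit Types v : 'rV[R]_n.

(* The library norm on ['rV_n] is the sup norm, hence these two. *)
Definition norm2 v : R := Num.sqrt (\sum_i v 0 i ^+ 2).

Definition norm1 v : R := \sum_i `|v 0 i|.

Definition pos_part v : 'rV[R]_n := \row_i Num.max 0 (v 0 i).

Lemma pos_part_ge0 v i : 0 <= pos_part v 0 i.
Proof. by rewrite mxE Order.TotalTheory.le_max lexx. Qed.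

Definition gradient (f : 'rV[R]_n -> R) (x : 'rV[R]_n) : 'rV[R]_n :=
  \row_i 'D_(delta_mx 0 i) f x.

End vectors.

Section iid.
Context d (T : measurableType d) (R : realType).

Definition tuple_cons m (z : T * m.-tuple T) : m.+1.-tuple T :=
  [tuple of z.1 :: z.2].

Lemma measurable_tuple_cons m : measurable_fun setT (@tuple_cons m).
Proof. exact: measurable_cons. Qed.

HB.instance Definition _ m :=
  isMeasurableFun.Build _ _ _ _ (@tuple_cons m) (@measurable_tuple_cons m).

(* [iid P m] is the [m]-fold product of [P], i.e. the joint law of [m]
   independent variables of law [P]; see [iid_rect]. *)
Fixpoint iid (P : probability T R) (m : nat) : probability (m.-tuple T) R :=
  match m with
  | 0 => \d_([tuple] : 0.-tuple T)
  | m'.+1 => distribution (P \x iid P m')%E (@tuple_cons m')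
  end.

Lemma iid_rect (P : probability T R) m (A : 'I_m -> set T) :
  (forall i, measurable (A i)) ->
  iid P m [set t | forall i, A i (tnth t i)] = (\prod_i P (A i))%E.
Proof.
elim: m A => [|m IHm] A mA /=.
  by rewrite big_ord0 diracE mem_set// => -[].
rewrite big_ord_recl -(IHm (fun i => A (lift ord0 i)))// /distribution.
have mB : measurable [set t : m.-tuple T | forall i, A (lift ord0 i) (tnth t i)].
  rewrite (_ : [set _ | _] =
      \bigcap_(i in setT) ((@tnth m T)^~ i @^-1` A (lift ord0 i))); last first.
    by apply/seteqP; split => t /= h i; [move=> _|]; exact: h.
  apply: fin_bigcap_measurable => // i _.
  by rewrite -[X in measurable X]setTI; exact: measurable_tnth.
rewrite -product_measure1E// /pushforward; congr (_ _).
apply/seteqP; split => -[a t] /=.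
  by move=> h; split => [|i]; [exact: (h ord0)|have := h (lift ord0 i); rewrite tnthS].
move=> [ha ht] i; case: (unliftP ord0 i) => [j|] -> //.
by rewrite tnthS.
Qed.

End iid.

Section pps.
Context {R : realType} {n : nat}.
Implicit Types v G : 'rV[R]_n.

(* The categorical law P_v with weights [v]_+ / ||[v]_+||_1. When [v]_+ = 0
   these are 0/0 and the law is taken to be uniform: the choice is immaterial,
   since [pps] then multiplies the drawn vectors by 0, but the weights must sum
   to 1 for the expectation below to be one. *)
Definition pps_weight v (k : 'I_n) : R :=
  if norm1 (pos_part v) == 0 then n%:R^-1
  else pos_part v 0 k / norm1 (pos_part v).

Lemma pps_weight_ge0 v k : 0 <= pps_weight v k.
Proof.
rewrite /pps_weight; case: ifP => _; first by rewrite invr_ge0 ler0n.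
apply: divr_ge0; first by apply: pos_part_ge0.
by rewrite /norm1; apply: sumr_ge0.
Qed.

Lemma sum_pps_weight v : (0 < n)%N -> \sum_k pps_weight v k = 1.
Proof.
move=> n0; rewrite /pps_weight; have [_|v0] := eqVneq (norm1 (pos_part v)) 0.
  by rewrite sumr_const card_ord -[LHS]mulr_natr mulVf// pnatr_eq0 -lt0n.
rewrite -mulr_suml -[RHS](divff v0); congr (_ / _).
by apply: eq_bigr => i _; rewrite ger0_norm ?pos_part_ge0.
Qed.

(* Expectation of [F k] for [k] with [M] independent components of law [p]. *)
Definition cat_expect (p : 'I_n -> R) M (F : M.-tuple 'I_n -> R) : R :=
  \sum_(k : M.-tuple 'I_n) (\prod_(i < M) p (tnth k i)) * F k.

Definition batch_mean (Xi : Type) (g : 'rV[R]_n -> Xi -> 'rV[R]_n) r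
    (x : 'rV[R]_n) (xi : r.-tuple Xi) : 'rV[R]_n :=
  r%:R^-1 *: \sum_(i < r) g x (tnth xi i).

Definition pps (Xi : Type) (g : 'rV[R]_n -> Xi -> 'rV[R]_n) r M
    (x : 'rV[R]_n) (xi : r.-tuple Xi) (k l : M.-tuple 'I_n) : 'rV[R]_n :=
  let G := batch_mean g x xi in
  (norm1 (pos_part G) / M%:R) *: \sum_(i < M) delta_mx 0 (tnth k i) -
  (norm1 (pos_part (- G)) / M%:R) *: \sum_(i < M) delta_mx 0 (tnth l i).

(* Expectation of [F (PPS(x, xi, k, l))] over [k], [l] given [xi]; [k] and [l]
   are drawn independently of each other. *)
Definition pps_cond_expect (Xi : Type) (g : 'rV[R]_n -> Xi -> 'rV[R]_n) r M
    (x : 'rV[R]_n) (xi : r.-tuple Xi) (F : 'rV[R]_n -> R) : R :=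
  let G := batch_mean g x xi in
  cat_expect (pps_weight G) (fun k : M.-tuple 'I_n =>
    cat_expect (pps_weight (- G)) (fun l : M.-tuple 'I_n =>
      F (pps g x xi k l))).

End pps.

Definition sigma2_rM (R : realType) (n r M : nat) (B sigma : R) : R :=
  50 * (2 * (1 - n%:R^-1) * B ^+ 2 / (expR 1 * M%:R) + sigma ^+ 2 / r%:R).

(* Main.v *)
Require Import Defs.
From HB Require Import structures.
From mathcomp Require Import all_boot all_order all_algebra.
From mathcomp Require Import all_classical all_reals all_analysis.
From mathcomp Require Import measurable_realfun ring lra.
Import Order.TTheory GRing.Theory Num.Theory.
Import numFieldNormedType.Exports.

Set Implicit Arguments.
Unset Strict Implicit.
Unset Printing Implicit Defensive.

Local Open Scope classical_set_scope.
Local Open Scope ring_scope.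

(** The error [pps - gradient f x] is the endpoint of a random walk in Euclidean
    space: its [r] first steps are the sampling errors
    [(g x xi_i - gradient f x) / r], its [2 * M] last ones the quantization errors [c *: (e_k - p)], where [p] is
    the law of [k] and [c] is [norm1 (pos_part G) / M] or
    [- norm1 (pos_part (- G)) / M]. Given the past, each step has mean zero.

    One step is controlled as follows. If [y] has mean zero and
    [expR (norm2 y ^+ 2 / v)] has expectation at most [expR 1], then for
    [6 * v < tau] the expectation of [expR (norm2 (s + y) ^+ 2 / tau)] is at most
    [expR ((v + norm2 s ^+ 2) / (tau - 6 * v))]: the step is traded for an
    additive cost [v] and a decrease of [tau] by [6 * v]. No dimension enters,
    since the increment of [norm2 s ^+ 2] is [2 * dot s y + norm2 y ^+ 2], the
    first summand is centered with square at most
    [4 * norm2 s ^+ 2 * norm2 y ^+ 2], and Young's inequality separates the two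
    ([expR_norm2D_le]). That lemma is a pointwise bound by an affine function of
    [dot s y] and [expR (norm2 y ^+ 2 / v)], so that integrating it, against a
    categorical law or against [P], only uses linearity.

    Iterating over steps of total size [V], the walk started at [0] satisfies the
    bound [expR (V / (tau - 6 * V))], which is at most [expR 1] as soon as
    [7 * V <= tau] ([categorical_walk] for the quantization steps,
    [subgaussian_walk] for the sampling steps). The sampling steps contribute
    [r * (sigma / r) ^+ 2 = sigma ^+ 2 / r]. Since
    [norm2 (e_k - p) ^+ 2 <= 4 * (1 - 1 / n)] and the [l1] norms of the positive
    and negative parts of [G] add up to at most [B], the quantization steps
    contribute at most [4 * (1 - 1 / n) * B ^+ 2 / M]. As [expR 1 <= 3], the
    constant 50 leaves enough room for [7 * V <= tau] ([sigma2_rM_ge]). *)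

(** * Scalar exponential inequalities *)

Section exponential.
Context {R : realType}.
Implicit Types x y u z m t : R.

(** Doubling the argument of a quadratic upper bound by squaring it; this enlarges
    the interval on which such a bound is known. *)
Lemma expR_le_quad_double (c c' : R) x :
    0 <= 1 + x / 2 + c * (x / 2) ^+ 2 ->
    expR (x / 2) <= 1 + x / 2 + c * (x / 2) ^+ 2 ->
    (1 + x / 2 + c * (x / 2) ^+ 2) ^+ 2 <= 1 + x + c' * x ^+ 2 ->
  expR x <= 1 + x + c' * x ^+ 2.
Proof.
move=> q0 hx; apply: le_trans.
by rewrite {1}(splitr x) expRD -expr2 ler_sqr ?nnegrE ?expR_ge0.
Qed.

(** Near [0] the bound follows from [expR (- y / 2) >= 1 - y / 2], inverted and
    squared; two doublings extend it from [|x| <= 1/4] to [|x| <= 1]. On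
    [|x| <= 1/2] the coefficient is [9 / 10], because the square of
    [1 + x / 2 + (x / 2) ^+ 2] exceeds [1 + x + x ^+ 2] at [x = 1]. *)
Lemma expR_le_quad x : `|x| <= 1 -> expR x <= 1 + x + x ^+ 2.
Proof.
have h1 y : `|y| <= 2^-1 ^+ 2 -> expR y <= 1 + y + 1 * y ^+ 2.
  move=> /ler_normlP[y1 y2].
  have e1 := expR_ge1Dx (- (y / 2)).
  have p1 : 0 < 1 + - (y / 2) by lra.
  rewrite {1}(splitr y) expRD -expr2.
  have := expRxMexpNx_1 (y / 2).
  have := expR_gt0 (y / 2).
  set a := expR (y / 2); set b := expR (- (y / 2)) in e1 * => a0 ab.
  have aw : a * (1 - y / 2) <= 1 by rewrite -[leRHS]ab ler_pM2l.
  have h : (a * (1 - y / 2)) ^+ 2 <= 1.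
    by rewrite expr_le1// mulr_ge0 ?ltW.
  have w2 : 0 < (1 - y / 2) ^+ 2 by rewrite exprn_gt0//.
  rewrite -(ler_pM2r w2) -exprMn (le_trans h)//.
  have hq : 0 <= 1 - 3 * y + y ^+ 2 by nra.
  have := mulr_ge0 (sqr_ge0 y) hq.
  nra.
have h2 y : `|y| <= 2^-1 -> expR y <= 1 + y + (9 / 10) * y ^+ 2.
  move=> /ler_normlP[y1 y2].
  apply: (@expR_le_quad_double 1); [nra| apply: h1|].
    by apply/ler_normlP; split; lra.
  have hq : 0 <= 3 / 20 - y / 4 - y ^+ 2 / 16 by nra.
  have := mulr_ge0 (sqr_ge0 y) hq; nra.
move=> /ler_normlP[x1 x2]; rewrite -[x ^+ 2]mul1r.
apply: (@expR_le_quad_double (9 / 10)); [nra|apply: h2|].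
  by apply/ler_normlP; split; lra.
have hq : 0 <= 3 / 10 - (9 / 40) * x - (81 / 1600) * x ^+ 2 by nra.
have := mulr_ge0 (sqr_ge0 x) hq; nra.
Qed.

(** The basic sub-Gaussian estimate: after integrating against a centered law the
    linear term disappears. *)
Lemma expR_le_addsqr x : expR x <= x + expR (x ^+ 2).
Proof.
have e2 := expR_ge1Dx (x ^+ 2).
have [x1|] := lerP `|x| 1; first by have := expR_le_quad x1; lra.
rewrite ltr_normr => /orP[x1|x1].
  have : expR x <= expR (x ^+ 2) by rewrite ler_expR; nra.
  lra.
have : expR x <= 1 by rewrite expR_le1; lra.
nra.
Qed.

(** Convexity of the exponential between [0] and [x], from its tangent line at
    [t * x]. It replaces Jensen's inequality for the power [t] in a form that is
    affine in [expR x]. *)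
Lemma expR_chord t x : 0 <= t <= 1 -> expR (t * x) <= 1 - t + t * expR x.
Proof.
move=> /andP[t0 t1]; set y := t * x.
have h1 : expR y * (1 + (x - y)) <= expR x.
  by rewrite -{2}(subrKC y x) expRD ler_pM2l ?expR_gt0// expR_ge1Dx.
have h0 : expR y * (1 - y) <= 1.
  by rewrite -[leRHS](expRxMexpNx_1 y) ler_pM2l ?expR_gt0// expR_ge1Dx.
have := lerD (ler_wpM2l t0 h1) (ler_wpM2l (_ : 0 <= 1 - t) h0).
rewrite subr_ge0 => /(_ t1); rewrite /y; lra.
Qed.

(** Young's inequality with exponents [3/2] and [3]; an exponent close to [1] on
    [x] keeps the loss on the leading term of a step small. *)
Lemma expR_young x y :
  expR (x + y) <= 2 / 3 * expR (3 / 2 * x) + 3^-1 * expR (3 * y).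
Proof.
have -> : 3 / 2 * x = x / 2 + (x / 2 + x / 2) by field.
have -> : 3 * y = y + (y + y) by ring.
have {1}-> : x = x / 2 + x / 2 by field.
rewrite !expRD; set a := expR (x / 2); set b := expR y.
have a0 : 0 <= a by apply: expR_ge0.
have b0 : 0 <= b by apply: expR_ge0.
have : 0 <= (a - b) ^+ 2 * (2 * a + b) by rewrite mulr_ge0 ?sqr_ge0//; lra.
lra.
Qed.

(** For [u] centered and [z] with [expR z] of expectation at most [expR 1], the
    expectation of the bracket is at most [1], so this bounds the Laplace
    transform of [u] by [expR m]. For small [m], [u ^+ 2] is absorbed by a
    fraction of [z]; for large [m], already [u <= (m + z) / 2] gives the bound,
    with [b = 0]. *)
Lemma expR_linearize m : 0 <= m -> exists b t, 0 <= t <= 1 /\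
  forall u z, 0 <= z -> u ^+ 2 <= m * z ->
    expR u <= expR m * (1 - t + t * expR (z - 1) + b * u).
Proof.
move=> m0; have [m1|m1] := lerP m 1.
  exists (expR (- m)), m; split; first by rewrite m0.
  move=> u z z0 uz; apply: (le_trans (expR_le_addsqr u)).
  rewrite mulrDr mulrA expRxMexpNx_1 mul1r addrC lerD2r.
  apply: (@le_trans _ _ (expR (m + m * (z - 1)))); first by rewrite ler_expR; lra.
  by rewrite expRD ler_pM2l ?expR_gt0// expR_chord// m0.
exists 0, 2^-1; split; first by lra.
move=> u z z0 uz; rewrite mul0r addr0.
have h2 : 0 <= (2^-1 : R) <= 1 by apply/andP; split; lra.
apply: (@le_trans _ _ (expR (m + 2^-1 * (z - 1)))); last first.
  by rewrite expRD ler_pM2l ?expR_gt0// expR_chord.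
rewrite ler_expR.
have : `|u| <= (m + z) / 2.
  rewrite -ler_sqr ?nnegrE//; last lra.
  rewrite real_normK ?num_real//; have := sqr_ge0 (m - z); nra.
by move=> /ler_normlP[_]; lra.
Qed.

End exponential.

(** * Euclidean geometry of row vectors *)

Section euclidean.
Context {R : realType} {n : nat}.
Implicit Types u v s : 'rV[R]_n.

Definition dot u v : R := \sum_i u 0 i * v 0 i.

Lemma norm2_sqr v : norm2 v ^+ 2 = dot v v.
Proof.
rewrite sqr_sqrtr; last by apply: sumr_ge0 => i _; apply: sqr_ge0.
by apply: eq_bigr => i _; rewrite expr2.
Qed.

Lemma dotC u v : dot u v = dot v u.
Proof. by apply: eq_bigr => i _; rewrite mulrC. Qed.

Lemma dotDr s u v : dot s (u + v) = dot s u + dot s v.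
Proof. by rewrite -big_split; apply: eq_bigr => i _; rewrite mxE mulrDr. Qed.

Lemma dotZr a s u : dot s (a *: u) = a * dot s u.
Proof. by rewrite mulr_sumr; apply: eq_bigr => i _; rewrite mxE mulrCA. Qed.

Lemma norm2_sqrD u v :
  norm2 (u + v) ^+ 2 = norm2 u ^+ 2 + 2 * dot u v + norm2 v ^+ 2.
Proof.
rewrite !norm2_sqr dotDr (dotC (u + v) u) (dotC (u + v) v) !dotDr (dotC v u).
ring.
Qed.

Lemma norm2_sqrZ a u : norm2 (a *: u) ^+ 2 = a ^+ 2 * norm2 u ^+ 2.
Proof. by rewrite !norm2_sqr dotZr dotC dotZr mulrA. Qed.

Lemma cauchy_schwarz u v : dot u v ^+ 2 <= norm2 u ^+ 2 * norm2 v ^+ 2.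
Proof.
have [v0|v0] := eqVneq (norm2 v ^+ 2) 0.
  have vi i : v 0 i = 0.
    move: v0; rewrite norm2_sqr => /eqP.
    rewrite psumr_eq0 => [/allP/(_ i)|j _]; last by rewrite -expr2 sqr_ge0.
    by rewrite mem_index_enum -expr2 sqrf_eq0 => /(_ isT)/implyP/(_ isT)/eqP.
  by rewrite v0 mulr0 /dot big1 ?expr0n// => i _; rewrite vi mulr0.
have vp : 0 < norm2 v ^+ 2 by rewrite lt_neqAle eq_sym v0 sqr_ge0.
have := sqr_ge0 (norm2 ((norm2 v ^+ 2) *: u + (- dot u v) *: v)).
rewrite norm2_sqrD !norm2_sqrZ dotZr (dotC (_ *: u)) dotZr (dotC v u).
set a := norm2 u ^+ 2; set b := norm2 v ^+ 2 in vp *; set c := dot u v.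
have -> : b ^+ 2 * a + 2 * (- c * (b * c)) + (- c) ^+ 2 * b =
  b * (a * b - c ^+ 2) by ring.
by rewrite pmulr_rge0// subr_ge0.
Qed.

End euclidean.

(** * One step of the random walk *)

Section step.
Context {R : realType} {n : nat}.

(** One step of the walk, before integration. The exponent is split as
    [norm2 s ^+ 2 / tau + x + y'] with [x = 2 * dot s y / tau] and
    [y' = norm2 y ^+ 2 / tau]. Young's inequality separates [x] from [y'],
    [expR_linearize] bounds the former at cost
    [m = 9 * norm2 s ^+ 2 * v / tau ^+ 2] before the factor [2 / 3], and
    [expR_chord] the latter at cost [v / tau]. Finally
    [1 / tau + 6 * v / tau ^+ 2 <= 1 / (tau - 6 * v)] puts the total cost into a
    form that composes exactly along the walk. *)
Lemma expR_norm2D_le (s : 'rV[R]_n) (v tau : R) : 0 < v -> 6 * v < tau ->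
  exists b t, 0 <= t <= 1 /\ forall y : 'rV[R]_n,
    expR (norm2 (s + y) ^+ 2 / tau) <=
    expR ((v + norm2 s ^+ 2) / (tau - 6 * v)) *
    (1 - t + t * expR (norm2 y ^+ 2 / v - 1) + b * dot s y).
Proof.
move=> v0 vtau; have tau0 : 0 < tau by lra.
set S := norm2 s ^+ 2; have S0 : 0 <= S by apply: sqr_ge0.
pose m := 9 * S * v / tau ^+ 2.
have m0 : 0 <= m.
  by rewrite mulr_ge0 ?invr_ge0 ?sqr_ge0// mulr_ge0 ?(ltW v0)// mulr_ge0.
have [b [t [t01 hbt]]] := expR_linearize m0.
pose t3 := 3 * (v / tau).
have t301 : 0 <= t3 <= 1.
  apply/andP; split; first by rewrite mulr_ge0// divr_ge0 ?ltW.
  by rewrite /t3 mulrA ler_pdivrMr//; lra.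
exists (2 / tau * b), (2 / 3 * t + 3^-1 * t3); split; first by lra.
move=> y; set z := norm2 y ^+ 2 / v.
have z0 : 0 <= z by rewrite divr_ge0 ?sqr_ge0 ?ltW.
have yz : norm2 y ^+ 2 = z * v by rewrite /z mulfVK// gt_eqF.
pose u := 3 * dot s y / tau.
have uz : u ^+ 2 <= m * z.
  have -> : m * z = 9 * (S * norm2 y ^+ 2) / tau ^+ 2.
    by rewrite /m yz; ring.
  rewrite /u expr_div_n exprMn ler_pM2r ?invr_gt0 ?exprn_gt0//.
  have -> : 3 ^+ 2 = 9 :> R by ring.
  by rewrite ler_pM2l ?cauchy_schwarz.
have {hbt} hu := hbt u z z0 uz.
have {}hu : expR (u - m) <= 1 - t + t * expR (z - 1) + b * u.
  by rewrite expRD expRN mulrC ler_pdivrMl ?expR_gt0.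
have hz := expR_chord (z - 1) t301.
have hY := expR_young (2 / 3 * (u - m)) (v / tau * (z - 1)).
have e1 : 3 / 2 * (2 / 3 * (u - m)) = u - m by field.
rewrite e1 (mulrA 3) -/t3 in hY.
have {hY} hY : expR (2 / 3 * (u - m) + v / tau * (z - 1)) <=
  1 - (2 / 3 * t + 3^-1 * t3) + (2 / 3 * t + 3^-1 * t3) * expR (z - 1) +
    2 / tau * b * dot s y.
  apply: (le_trans hY).
  have -> : 2 / tau * b * dot s y = 2 / 3 * (b * u).
    by rewrite /u; field; rewrite gt_eqF.
  by lra.
apply: (@le_trans _ _ (expR ((v + S) / (tau - 6 * v)) *
   expR (2 / 3 * (u - m) + v / tau * (z - 1)))); last first.
  by rewrite ler_pM2l ?expR_gt0.
rewrite -expRD ler_expR norm2_sqrD -/S yz.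
have d0 : 0 < tau - 6 * v by lra.
have -> : (S + 2 * dot s y + z * v) / tau =
   (S / tau + 6 * S * v / tau ^+ 2 + v / tau) +
   (2 / 3 * (u - m) + v / tau * (z - 1)).
  by rewrite /u /m; field; rewrite gt_eqF.
rewrite lerD2r.
have h1 : 1 / tau + 6 * v / tau ^+ 2 <= (tau - 6 * v)^-1.
  rewrite -subr_ge0.
  have -> : (tau - 6 * v)^-1 - (1 / tau + 6 * v / tau ^+ 2) =
     (6 * v) ^+ 2 / (tau ^+ 2 * (tau - 6 * v)).
    by field; rewrite !gt_eqF.
  by rewrite divr_ge0 ?sqr_ge0// mulr_ge0 ?sqr_ge0 ?ltW.
have h2 : v / tau <= v / (tau - 6 * v).
  by rewrite ler_pM2l// lef_pV2 ?posrE//; lra.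
have -> : S / tau + 6 * S * v / tau ^+ 2 = S * (1 / tau + 6 * v / tau ^+ 2).
  by ring.
by rewrite (mulrDl v) addrC lerD// ler_wpM2l.
Qed.

End step.

Section exponent.
Context {R : realType}.
Implicit Types v w S tau : R.

(** Costs [v] already paid at level [tau] and [w] paid by lowering the level merge
    into a single cost at the final level. *)
Lemma walk_exponentD v w S tau : 0 <= v -> 0 <= w -> 6 * w < tau ->
  v / tau + (w + S) / (tau - 6 * w) <= (v + w + S) / (tau - 6 * w).
Proof.
move=> v0 w0 wtau; have d0 : 0 < tau - 6 * w by lra.
rewrite -addrA (mulrDl v) lerD2r ler_wpM2l// lef_pV2 ?posrE//; lra.
Qed.

Lemma walk_exponent_mono v w S tau :
    0 <= v -> 0 <= S -> v <= w -> 6 * w < tau ->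
  (v + S) / (tau - 6 * v) <= (w + S) / (tau - 6 * w).
Proof.
move=> v0 S0 vw wtau.
apply: ler_pM; [lra|rewrite invr_ge0; lra|lra|rewrite lef_pV2 ?posrE//; lra].
Qed.

End exponent.

Lemma sum_tuple_cons (T : Type) (V : zmodType) M (X : T -> V) k (t : M.-tuple T) :
  \sum_(i < M.+1) X (tnth [tuple of k :: t] i) =
  X k + \sum_(i < M) X (tnth t i).
Proof.
by rewrite big_ord_recl tnth0; congr (_ + _); apply: eq_bigr => i _; rewrite tnthS.
Qed.

(** * Walks with categorical steps *)

Section categorical.
Context {R : realType} {n : nat}.
Implicit Types (p : 'I_n -> R) (s : 'rV[R]_n) (rho tau : R).

Lemma cat_expect_cons p M (F : M.+1.-tuple 'I_n -> R) :
  cat_expect p F = \sum_k p k * cat_expect p (fun t => F [tuple of k :: t]).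
Proof.
transitivity (\sum_(z : 'I_n * M.-tuple 'I_n)
    p z.1 * ((\prod_(i < M) p (tnth z.2 i)) * F [tuple of z.1 :: z.2])).
  pose h (z : 'I_n * M.-tuple 'I_n) : M.+1.-tuple 'I_n := [tuple of z.1 :: z.2].
  rewrite /cat_expect (reindex h) /=; last first.
    exists (fun t => (thead t, [tuple of behead t])) => [[k t] _|t _].
      by congr pair; apply: val_inj.
    by rewrite /h /= -tuple_eta.
  apply: eq_bigr => -[k t] _; rewrite big_ord_recl mulrA /= tnth0.
  by congr (_ * _ * _); apply: eq_bigr => i _; rewrite tnthS.
rewrite -(pair_big xpredT xpredT (fun k (t : M.-tuple 'I_n) =>
  p k * ((\prod_(i < M) p (tnth t i)) * F [tuple of k :: t]))) /=.
by apply: eq_bigr => k _; rewrite mulr_sumr.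
Qed.

Lemma ler_cat_expect p M (F H : M.-tuple 'I_n -> R) :
  (forall k, 0 <= p k) -> (forall k, F k <= H k) ->
  cat_expect p F <= cat_expect p H.
Proof.
by move=> p0 FH; apply: ler_sum => k _; rewrite ler_wpM2l// prodr_ge0.
Qed.

Lemma cat_expectZ p M c (F : M.-tuple 'I_n -> R) :
  cat_expect p (fun k => c * F k) = c * cat_expect p F.
Proof. by rewrite mulr_sumr; apply: eq_bigr => k _; rewrite mulrCA. Qed.

(** A step bounded by [rho] is sub-Gaussian of size [rho]. The case [rho = 0] is
    treated apart because then no positive size is available: it occurs when
    [n = 1] or when one of the two parts of the gradient estimate vanishes. *)
Lemma categorical_step p (X : 'I_n -> 'rV[R]_n) s rho tau :
    (forall k, 0 <= p k) -> \sum_k p k = 1 -> \sum_k p k *: X k = 0 ->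
    (forall k, norm2 (X k) ^+ 2 <= rho) -> 0 <= rho -> 6 * rho < tau ->
  \sum_k p k * expR (norm2 (s + X k) ^+ 2 / tau) <=
  expR ((rho + norm2 s ^+ 2) / (tau - 6 * rho)).
Proof.
move=> p0 p1 pX Xrho rho0 rhotau.
suff [b hb] : exists b, forall k, expR (norm2 (s + X k) ^+ 2 / tau) <=
    expR ((rho + norm2 s ^+ 2) / (tau - 6 * rho)) * (1 + b * dot s (X k)).
  apply: (@le_trans _ _ (\sum_k p k *
      (expR ((rho + norm2 s ^+ 2) / (tau - 6 * rho)) * (1 + b * dot s (X k))))).
    by apply: ler_sum => k _; rewrite ler_wpM2l.
  have dX : \sum_k p k * dot s (X k) = 0.
    transitivity (dot s (\sum_k p k *: X k)).
      rewrite /dot; under eq_bigr do rewrite mulr_sumr.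
      rewrite exchange_big; apply: eq_bigr => i _.
      rewrite summxE mulr_sumr; apply: eq_bigr => k _.
      by rewrite mxE mulrCA.
    by rewrite pX /dot big1// => i _; rewrite mxE mulr0.
  under eq_bigr do rewrite mulrCA mulrDr mulr1 (mulrCA _ b).
  by rewrite -mulr_sumr big_split /= -mulr_sumr p1 dX mulr0 addr0 mulr1.
have [r0|r0] := eqVneq rho 0.
  exists 0 => k; rewrite mul0r addr0 mulr1 r0 add0r mulr0 subr0.
  have X0 : norm2 (X k) ^+ 2 = 0.
    by apply/eqP; rewrite eq_le sqr_ge0 andbT -[leRHS]r0.
  have /eqP d0 : dot s (X k) == 0.
    rewrite -sqrf_eq0 eq_le sqr_ge0 andbT (le_trans (cauchy_schwarz _ _))//.
    by rewrite X0 mulr0.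
  by rewrite norm2_sqrD X0 d0 mulr0 !addr0.
have {}r0 : 0 < rho by rewrite lt_neqAle eq_sym r0.
have [b [t [/andP[t0 t1] hb]]] := expR_norm2D_le s r0 rhotau.
exists b => k; apply: (le_trans (hb (X k))).
rewrite ler_pM2l ?expR_gt0// lerD2r.
have : expR (norm2 (X k) ^+ 2 / rho - 1) <= 1.
  by rewrite expR_le1 subr_le0 ler_pdivrMr// mul1r.
by move=> /(ler_wpM2l t0); lra.
Qed.

(** The first step is taken last: the induction hypothesis, started from [s + X k],
    bounds the rest of the walk, and the step lemma applies to what remains at the
    lowered level. *)
Lemma categorical_walk p (X : 'I_n -> 'rV[R]_n) rho :
    (forall k, 0 <= p k) -> \sum_k p k = 1 -> \sum_k p k *: X k = 0 ->
    (forall k, norm2 (X k) ^+ 2 <= rho) -> 0 <= rho ->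
  forall M s tau, 6 * (M%:R * rho) < tau ->
  cat_expect p (fun k : M.-tuple 'I_n =>
    expR (norm2 (s + \sum_(i < M) X (tnth k i)) ^+ 2 / tau)) <=
  expR ((M%:R * rho + norm2 s ^+ 2) / (tau - 6 * (M%:R * rho))).
Proof.
move=> p0 p1 pX Xrho rho0; elim => [|M IHM] s tau hM.
  rewrite /cat_expect (big_pred1 [tuple]) => [|t]; last first.
    by apply/esym/eqP; exact: tuple0.
  by rewrite !big_ord0 mul1r addr0 !mul0r add0r mulr0 subr0.
have Mr : M.+1%:R * rho = M%:R * rho + rho by rewrite -natr1 mulrDl mul1r.
rewrite Mr in hM *.
have M0 : 0 <= M%:R * rho by rewrite mulr_ge0.
rewrite cat_expect_cons.
set tau' := tau - 6 * (M%:R * rho).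
have tau'0 : 6 * rho < tau' by rewrite /tau'; lra.
apply: (@le_trans _ _ (\sum_k p k *
    (expR (M%:R * rho / tau') * expR (norm2 (s + X k) ^+ 2 / tau')))).
  apply: ler_sum => k _; rewrite ler_wpM2l//.
  have hM' : 6 * (M%:R * rho) < tau by lra.
  rewrite -expRD -mulrDl; apply: le_trans (IHM (s + X k) tau hM').
  rewrite le_eqVlt; apply/orP; left; apply/eqP; apply: eq_bigr => t _.
  by rewrite sum_tuple_cons addrA.
under eq_bigr do rewrite mulrCA.
rewrite -mulr_sumr.
apply: (@le_trans _ _ (expR (M%:R * rho / tau') *
    expR ((rho + norm2 s ^+ 2) / (tau' - 6 * rho)))).
  by rewrite ler_pM2l ?expR_gt0// categorical_step.
rewrite -expRD ler_expR.
have -> : tau - 6 * (M%:R * rho + rho) = tau' - 6 * rho by rewrite /tau'; ring.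
exact: walk_exponentD.
Qed.

End categorical.

(** * Walks with sub-Gaussian steps *)

Section measurability.
Local Open Scope ereal_scope.
Context d (T : measurableType d) (R : realType) (n : nat).

(** For nonnegative integrands on the whole space, monotonicity needs no
    measurability, as the integral is a supremum over simple functions below the
    integrand. This spares the measurability in [xi] of [pps_cond_expect]. *)
Lemma ge0_le_integralT (mu : {measure set T -> \bar R}) (f1 f2 : T -> \bar R) :
    (forall x, 0 <= f1 x) -> (forall x, f1 x <= f2 x) ->
  \int[mu]_x f1 x <= \int[mu]_x f2 x.
Proof.
move=> f10 f12; have f20 x : 0 <= f2 x by exact: le_trans (f12 x).
rewrite !ge0_integralTE//; apply: ereal_sup_le => _ [h hf <-].
by exists h => // x; exact: le_trans (f12 x).
Qed.

Lemma measurable_norm2_sqr (V : T -> 'rV[R]_n) :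
    (forall j, measurable_fun setT (fun x => V x 0 j)%R) ->
  measurable_fun setT (fun x => norm2 (V x) ^+ 2)%R.
Proof.
move=> mV; under eq_fun do rewrite norm2_sqr.
by apply: measurable_sum => j; exact: measurable_funM.
Qed.

Lemma measurable_expR_norm2 (V : T -> 'rV[R]_n) (tau : R) :
    (forall j, measurable_fun setT (fun x => V x 0 j)%R) ->
  measurable_fun setT (fun x => (expR (norm2 (V x) ^+ 2 / tau))%:E).
Proof.
move=> mV; apply/measurable_EFinP; apply: measurableT_comp => //.
by apply: measurable_funM => //; exact: measurable_norm2_sqr.
Qed.

End measurability.

Section subgaussian.
Local Open Scope ereal_scope.
Context d (T : measurableType d) (R : realType) (n : nat).
Variables (P : probability T R) (Y : T -> 'rV[R]_n) (v : R).
Hypothesis v0 : (0 < v)%R.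
Hypothesis iY : forall j, P.-integrable setT (fun x => (Y x 0%R j)%:E).
Hypothesis EY : forall j, \int[P]_x (Y x 0%R j)%:E = 0.
Hypothesis expY : \int[P]_x (expR (norm2 (Y x) ^+ 2 / v))%:E <= (expR 1)%:E.

Let mY j : measurable_fun setT (fun x => Y x 0 j)%R.
Proof. by have /measurable_int/measurable_EFinP := iY j. Qed.

Let integrable_dot (s : 'rV[R]_n) : P.-integrable setT (fun x => (dot s (Y x))%:E).
Proof.
under eq_fun do rewrite -sumEFin.
apply: integrable_sum => // j _.
by under eq_fun do rewrite EFinM; exact: integrableZl.
Qed.

Let integral_dot (s : 'rV[R]_n) : \int[P]_x (dot s (Y x))%:E = 0.
Proof.
under eq_integral do rewrite -sumEFin.
rewrite integral_sum//; last first.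
  by move=> j; under eq_fun do rewrite EFinM; exact: integrableZl.
rewrite big1// => j _; under eq_integral do rewrite EFinM.
by rewrite integralZl// EY mule0.
Qed.

Lemma subgaussian_step (s : 'rV[R]_n) (tau : R) : (6 * v < tau)%R ->
  \int[P]_x (expR (norm2 (s + Y x) ^+ 2 / tau))%:E <=
  (expR ((v + norm2 s ^+ 2) / (tau - 6 * v)))%:E.
Proof.
move=> vtau; have [b [t [/andP[t0 t1] hb]]] := expR_norm2D_le s v0 vtau.
set C := expR _ in hb *.
pose W x := expR (norm2 (Y x) ^+ 2 / v).
have mW : measurable_fun setT (fun x => (W x)%:E) by exact: measurable_expR_norm2.
have W0 x : (0 <= W x)%R by apply: expR_ge0.
have iW : P.-integrable setT (fun x => (W x)%:E).
  apply/integrableP; split => //; under eq_integral do rewrite gee0_abs ?lee_fin//.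
  by rewrite (le_lt_trans expY)// ltry.
(* The weight of [expR (norm2 y ^+ 2 / v)] once the shift by 1 is factored out. *)
pose w := (t * expR (- 1))%R.
apply: (@le_trans _ _ (\int[P]_x (((C * (1 - t))%:E + (C * w)%:E * (W x)%:E)
    + (C * b)%:E * (dot s (Y x))%:E))).
  apply: ge0_le_integralT => x; first by rewrite lee_fin expR_ge0.
  rewrite -!EFinM -!EFinD lee_fin (le_trans (hb (Y x)))//.
  rewrite expRD -/(W x) /w le_eqVlt; apply/orP; left; apply/eqP; ring.
have ic : P.-integrable setT (fun _ => (C * (1 - t))%:E).
  exact: finite_measure_integrable_cst.
have i1 : P.-integrable setT (fun x => (C * (1 - t))%:E + (C * w)%:E * (W x)%:E).
  by apply: integrableD => //; exact: integrableZl.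
rewrite integralD//; last exact: integrableZl.
rewrite integralD//; last exact: integrableZl.
rewrite !integralZl// integral_dot mule0 adde0 integral_cst//.
rewrite [X in _ * X + _](_ : _ = 1) ?mule1; last exact: probability_setT.
apply: (@le_trans _ _ ((C * (1 - t))%:E + (C * w)%:E * (expR 1)%:E)).
  rewrite leeD2l// lee_wpmul2l// lee_fin.
  by rewrite /w mulr_ge0 ?expR_ge0// mulr_ge0// expR_ge0.
rewrite -EFinM -EFinD lee_fin /w.
have := expRxMexpNx_1 (1 : R); set e := expR 1; set e' := expR (- 1) => ee.
have -> : (C * (1 - t) + C * (t * e') * e = C * (1 - t) + C * t * (e * e'))%R.
  by ring.
by rewrite ee; lra.
Qed.

(** The induction of [categorical_walk], with Tonelli's theorem splitting off the
    first coordinate of the product law. *)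
Lemma subgaussian_walk m (s : 'rV[R]_n) (tau : R) : (6 * (m%:R * v) < tau)%R ->
  \int[iid P m]_t (expR (norm2 (s + \sum_(i < m) Y (tnth t i)) ^+ 2 / tau))%:E <=
  (expR ((m%:R * v + norm2 s ^+ 2) / (tau - 6 * (m%:R * v))))%:E.
Proof.
elim: m s tau => [|m IHm] s tau hm.
  rewrite /= integral_dirac//; last first.
    apply: measurable_expR_norm2 => j; under eq_fun do rewrite big_ord0 addr0.
    exact: measurable_cst.
  rewrite diracE mem_set// mul1e big_ord0 addr0.
  by rewrite !mul0r add0r mulr0 subr0.
have Mr : (m.+1%:R * v = m%:R * v + v)%R by rewrite -natr1 mulrDl mul1r.
rewrite Mr in hm *.
have m0 : (0 <= m%:R * v)%R by rewrite mulr_ge0// ltW.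
set tau' := (tau - 6 * (m%:R * v))%R.
have tau'0 : (6 * v < tau')%R by rewrite /tau'; lra.
have mS j k : measurable_fun setT
    (fun t : k.-tuple T => (s + \sum_(i < k) Y (tnth t i)) 0 j)%R.
  under eq_fun do rewrite mxE summxE.
  apply: measurable_funD => //; apply: measurable_sum => i.
  exact: (measurableT_comp (mY j) (measurable_tnth i)).
have mF k : measurable_fun setT (fun t : k.-tuple T =>
    (expR (norm2 (s + \sum_(i < k) Y (tnth t i)) ^+ 2 / tau))%:E).
  by apply: measurable_expR_norm2 => j; exact: mS.
rewrite [iid P m.+1]/= (ge0_integral_distribution _ (mF m.+1)); last first.
  by move=> t; rewrite lee_fin expR_ge0.
rewrite fubini_tonelli1; last 2 first.
- exact: measurableT_comp (mF m.+1) (@measurable_tuple_cons _ _ _).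
- by move=> z; rewrite /= lee_fin expR_ge0.
apply: (@le_trans _ _ (\int[P]_x ((expR (m%:R * v / tau'))%:E *
    (expR (norm2 (s + Y x) ^+ 2 / tau'))%:E))).
  apply: ge0_le_integralT => x.
    by apply: integral_ge0 => t _; rewrite lee_fin expR_ge0.
  rewrite -EFinM -expRD -mulrDl.
  have hm' : (6 * (m%:R * v) < tau)%R by move: tau'0 (v0); rewrite /tau'; lra.
  apply: le_trans (IHm (s + Y x)%R tau hm').
  rewrite le_eqVlt; apply/orP; left; apply/eqP; apply: eq_integral => t _ /=.
  by rewrite sum_tuple_cons addrA.
rewrite ge0_integralZl//; last first.
  apply: measurable_expR_norm2 => j; under eq_fun do rewrite mxE.
  exact: measurable_funD.
apply: (le_trans (lee_wpmul2l _ (subgaussian_step s tau'0))).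
  by rewrite lee_fin expR_ge0.
rewrite -EFinM -expRD lee_fin ler_expR.
have -> : (tau - 6 * (m%:R * v + v) = tau' - 6 * v)%R by rewrite /tau'; ring.
by apply: walk_exponentD => //; exact: ltW.
Qed.

End subgaussian.

(** * The quantization noise *)

Section quantization.
Context {R : realType} {n : nat}.
Implicit Types (p : 'I_n -> R) (G v : 'rV[R]_n).

(** The error, up to scaling, of replacing a law by one sample of it. *)
Definition centered_basis p (k : 'I_n) : 'rV[R]_n :=
  delta_mx 0 k - \row_j p j.

Lemma sum_centered_basis p c : \sum_k p k = 1 ->
  \sum_k p k *: (c *: centered_basis p k) = 0.
Proof.
move=> p1; apply/rowP => j; rewrite summxE mxE.
under eq_bigr do rewrite !mxE /= mulrCA mulrBr.
rewrite -mulr_sumr sumrB -mulr_suml p1 mul1r.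
rewrite (bigD1 j)//= eqxx mulr1 big1 ?addr0 ?subrr ?mulr0// => k kj.
by rewrite eq_sym (negbTE kj) mulr0.
Qed.

(** Always at most [2], because [(x - y) ^+ 2 <= x + y] for [x] and [y] in the unit
    interval; and [2 <= 4 * (1 - 1 / n)] unless [n = 1], when the only law is
    deterministic. *)
Lemma norm2_centered_basis p k : (forall j, 0 <= p j) -> \sum_j p j = 1 ->
  norm2 (centered_basis p k) ^+ 2 <= 4 * (1 - n%:R^-1).
Proof.
move=> p0 p1; have n0 : (0 < n)%N by case: (n) k => // -[].
have [n1|n1] := leqP n 1.
  have en : n = 1%N by apply/eqP; rewrite eqn_leq n1 n0.
  have all_k (j : 'I_n) : j = k.
    apply: val_inj; case: j k => [j hj] [k' hk] /=; move: hj hk.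
    by rewrite en !ltnS !leqn0 => /eqP-> /eqP->.
  have pk : p k = 1.
    by rewrite -p1 (bigD1 k)//= big1 ?addr0// => i; rewrite (all_k i) eqxx.
  rewrite norm2_sqr /dot big1 => [|j _]; first by rewrite en invr1 subrr mulr0.
  by rewrite !mxE (all_k j) !eqxx pk subrr mulr0.
have hn : n%:R^-1 <= 2^-1 :> R by rewrite lef_pV2 ?posrE ?ltr0n// ler_nat.
apply: (@le_trans _ _ 2); last lra.
rewrite norm2_sqr.
have -> : 2 = \sum_j ((j == k)%:R + p j) :> R.
  rewrite big_split /= p1 (bigD1 k)//= eqxx big1 ?addr0//.
  by move=> j /negbTE ->.
apply: ler_sum => j _; rewrite !mxE eqxx /=.
have pj1 : p j <= 1.
  by rewrite -p1 (bigD1 j)//= lerDl sumr_ge0.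
have h : 0 <= p j * (1 - p j) by rewrite mulr_ge0 ?subr_ge0.
by have pj0 := p0 j; case: (j == k); rewrite ?mulr1n ?mulr0n; lra.
Qed.

Lemma norm1_ge0 v : 0 <= norm1 v.
Proof. exact: sumr_ge0. Qed.

(** Without positive coordinates both sides vanish, so the uniform convention in
    [pps_weight] is harmless. *)
Lemma norm1_pos_partM v k : norm1 (pos_part v) * pps_weight v k = pos_part v 0 k.
Proof.
rewrite /pps_weight; have [v0|v0] := eqVneq (norm1 (pos_part v)) 0.
  rewrite v0 mul0r; have /eqP := v0.
  rewrite psumr_eq0// => /allP/(_ k); rewrite mem_index_enum => /(_ isT).
  by rewrite normr_eq0 => /eqP.
by rewrite mulrCA divff// mulr1.
Qed.

Lemma pos_part_sub G : pos_part G - pos_part (- G) = G.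
Proof.
apply/rowP => j; rewrite !mxE.
have [h|h] := lerP 0 (G 0 j); have [h'|h'] := lerP 0 (- G 0 j); lra.
Qed.

Lemma norm1_pos_partD G : norm1 (pos_part G) + norm1 (pos_part (- G)) = norm1 G.
Proof.
rewrite -big_split; apply: eq_bigr => j _ /=.
rewrite !(ger0_norm (pos_part_ge0 _ _)) !mxE.
have [h|h] := lerP 0 (G 0 j); have [h'|h'] := lerP 0 (- G 0 j);
  rewrite ?(ger0_norm h) ?(ltr0_norm h); lra.
Qed.

Lemma empirical_sumE v M (k : M.-tuple 'I_n) : (0 < M)%N ->
  (norm1 (pos_part v) / M%:R) *: \sum_(i < M) delta_mx 0 (tnth k i) =
  pos_part v + \sum_(i < M) (norm1 (pos_part v) / M%:R) *:
    centered_basis (pps_weight v) (tnth k i).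
Proof.
move=> M0; have M0' : M%:R != 0 :> R by rewrite pnatr_eq0 -lt0n.
rewrite -scaler_sumr sumrB scalerBr addrCA -[LHS]addr0; congr (_ + _).
apply/rowP => j; have := norm1_pos_partM v j.
rewrite sumr_const card_ord !mxE mulmxnE mxE => <-.
by rewrite -mulr_natl; field.
Qed.

Lemma pps_sub_gradE (Xi : Type) (g : 'rV[R]_n -> Xi -> 'rV[R]_n) r M x
    (xi : r.-tuple Xi) (k l : M.-tuple 'I_n) mu : (0 < M)%N ->
  let G := batch_mean g x xi in
  pps g x xi k l - mu =
  G - mu
  + \sum_(i < M) (norm1 (pos_part G) / M%:R) *:
      centered_basis (pps_weight G) (tnth k i)
  + \sum_(i < M) (- (norm1 (pos_part (- G)) / M%:R)) *:
      centered_basis (pps_weight (- G)) (tnth l i).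
Proof.
move=> M0 G; rewrite /pps -/G !empirical_sumE//.
under [X in _ = _ + X]eq_bigr do rewrite scaleNr.
rewrite sumrN opprD addrACA pos_part_sub.
by rewrite -!addrA; congr (_ + _); rewrite addrA addrC.
Qed.

(** Given [xi], the [2 * M] quantization steps start from [G - mu]: the walk driven
    by [l] is bounded first, for fixed [k], and then the walk driven by [k]. *)
Lemma pps_cond_expect_le (Xi : Type) (g : 'rV[R]_n -> Xi -> 'rV[R]_n) r M x
    (xi : r.-tuple Xi) mu (B tau : R) : (0 < n)%N -> (0 < M)%N ->
  let G := batch_mean g x xi in
  let v := 4 * (1 - n%:R^-1) * B ^+ 2 / M%:R in
  norm1 G <= B -> 6 * v < tau ->
  pps_cond_expect g M x xi (fun y => expR (norm2 (y - mu) ^+ 2 / tau)) <=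
  expR ((v + norm2 (G - mu) ^+ 2) / (tau - 6 * v)).
Proof.
move=> n0 M0 G v GB vtau; rewrite /pps_cond_expect -/G.
have M0' : M%:R != 0 :> R by rewrite pnatr_eq0 -lt0n.
set a := norm1 (pos_part G); set b := norm1 (pos_part (- G)).
have a0 : 0 <= a by exact: norm1_ge0.
have b0 : 0 <= b by exact: norm1_ge0.
have abB : a ^+ 2 + b ^+ 2 <= B ^+ 2.
  have : a + b <= B by rewrite norm1_pos_partD.
  by nra.
have kap0 : 0 <= 4 * (1 - n%:R^-1) :> R.
  by rewrite mulr_ge0// subr_ge0 invf_le1 ?ltr0n// ler1n.
set kap := 4 * (1 - n%:R^-1) in v vtau kap0 *.
have walk c H s t : 6 * (M%:R * (c ^+ 2 * kap)) < t ->
    cat_expect (pps_weight H) (fun k : M.-tuple 'I_n => expR (norm2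
      (s + \sum_(i < M) c *: centered_basis (pps_weight H) (tnth k i)) ^+ 2 / t)) <=
    expR ((M%:R * (c ^+ 2 * kap) + norm2 s ^+ 2) /
      (t - 6 * (M%:R * (c ^+ 2 * kap)))).
  have H1 := sum_pps_weight H n0.
  apply: (@categorical_walk _ _ (pps_weight H)
    (fun k => c *: centered_basis (pps_weight H) k)) => //.
  - by move=> k; exact: pps_weight_ge0.
  - exact: sum_centered_basis.
  - move=> k; rewrite norm2_sqrZ ler_wpM2l ?sqr_ge0// norm2_centered_basis//.
    by move=> j; exact: pps_weight_ge0.
  - exact: mulr_ge0 (sqr_ge0 _) kap0.
pose va := M%:R * ((a / M%:R) ^+ 2 * kap).
pose vb := M%:R * ((- (b / M%:R)) ^+ 2 * kap).
have va0 : 0 <= va.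
  exact: mulr_ge0 (ler0n _ _) (mulr_ge0 (sqr_ge0 _) kap0).
have vb0 : 0 <= vb.
  exact: mulr_ge0 (ler0n _ _) (mulr_ge0 (sqr_ge0 _) kap0).
have vab : va + vb <= v.
  have -> : va + vb = kap * (a ^+ 2 + b ^+ 2) / M%:R by rewrite /va /vb; field.
  by rewrite ler_wpM2r ?invr_ge0// ler_wpM2l.
set tb := tau - 6 * vb.
have htb : 6 * va < tb by rewrite /tb; lra.
set S := norm2 (G - mu) ^+ 2; have S0 : 0 <= S by exact: sqr_ge0.
pose X := fun k => (a / M%:R) *: centered_basis (pps_weight G) k.
apply: (@le_trans _ _ (cat_expect (pps_weight G) (fun k : M.-tuple 'I_n =>
    expR (vb / tb) * expR (norm2 (G - mu + \sum_(i < M) X (tnth k i)) ^+ 2 / tb)))).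
  apply: ler_cat_expect => [j|k]; first exact: pps_weight_ge0.
  rewrite -expRD -mulrDl.
  under [X in cat_expect _ X]eq_fun do rewrite pps_sub_gradE//.
  by apply: walk; rewrite -/vb; lra.
rewrite cat_expectZ.
apply: (@le_trans _ _ (expR (vb / tb) * expR ((va + S) / (tb - 6 * va)))).
  by rewrite ler_pM2l ?expR_gt0//; exact: walk.
rewrite -expRD ler_expR (le_trans (walk_exponentD _ vb0 va0 htb))//.
have -> : tb - 6 * va = tau - 6 * (vb + va) by rewrite /tb; ring.
by apply: walk_exponent_mono; lra.
Qed.

End quantization.

(** * The quantized oracle *)

(** On the quantization part the comparison reads [28 <= 100 / expR 1], on the
    sampling part [7 <= 50]. *)
Lemma sigma2_rM_ge (R : realType) (n r M : nat) (B sigma : R) :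
    (0 < n)%N ->
  7 * (4 * (1 - n%:R^-1) * B ^+ 2 / M%:R + sigma ^+ 2 / r%:R) <=
  sigma2_rM n r M B sigma.
Proof.
move=> n0; rewrite /sigma2_rM invfM.
have e3 : expR 1 <= 3 :> R.
  by have := @expR_le_quad R 1; rewrite normr1 => /(_ (lexx _)); lra.
have eV : 28 / 100 <= (expR 1)^-1 :> R.
  apply: (@le_trans _ _ 3^-1); first lra.
  by rewrite lef_pV2 ?posrE ?expR_gt0.
have k0 : 0 <= (1 - n%:R^-1) * B ^+ 2 / M%:R :> R.
  rewrite mulr_ge0 ?invr_ge0// mulr_ge0 ?sqr_ge0//.
  by rewrite subr_ge0 invf_le1 ?ltr0n// ler1n.
have s0 : 0 <= sigma ^+ 2 / r%:R by rewrite divr_ge0 ?sqr_ge0.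
have := ler_wpM2l k0 eV.
set K := _ * _ / _ => h.
have -> : 4 * (1 - n%:R^-1) * B ^+ 2 / M%:R = 4 * K by rewrite /K; ring.
have -> : 2 * (1 - n%:R^-1) * B ^+ 2 * ((expR 1)^-1 * M%:R^-1) = 2 * (K / expR 1).
  by rewrite /K; ring.
lra.
Qed.

Theorem lemma1 (R : realType) (n : nat) (hn : (0 < n)%N)
    (f : 'rV[R]_n -> R) (hf : forall x : 'rV[R]_n, differentiable f x)
    (d : measure_display) (Xi : measurableType d) (P : probability Xi R)
    (g : 'rV[R]_n -> Xi -> 'rV[R]_n)
    (hgm : forall x i, measurable_fun setT (fun xi => g x xi 0 i))
    (sigma B : R) (hsigma : 0 < sigma)
    (hmean : forall x i,
      ('E_P[(fun xi => g x xi 0 i)%R] = (gradient f x 0 i)%:E)%E)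
    (htail : forall x,
      ('E_P[(fun xi => expR (norm2 (g x xi - gradient f x) ^+ 2
                             / sigma ^+ 2))%R] <= (expR 1)%:E)%E)
    (hB : forall x xi, norm1 (g x xi) <= B)
    (r M : nat) (hr : (0 < r)%N) (hM : (0 < M)%N) :
  forall x : 'rV[R]_n,
    ('E_(iid P r)[(fun xi => pps_cond_expect g M x xi
        (fun y => expR (norm2 (y - gradient f x) ^+ 2
                        / sigma2_rM n r M B sigma)))%R]
      <= (expR 1)%:E)%E.
Proof.
move=> x; rewrite unlock; set mu := gradient f x; set tau := sigma2_rM n r M B sigma.
have r0 : r%:R != 0 :> R by rewrite pnatr_eq0 -lt0n.
have rp : 0 < r%:R :> R by rewrite ltr0n.
pose Y xi : 'rV[R]_n := r%:R^-1 *: (g x xi - mu).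
pose v := (sigma / r%:R) ^+ 2.
have v0 : 0 < v by rewrite exprn_gt0// divr_gt0.
set w := 4 * (1 - n%:R^-1) * B ^+ 2 / M%:R.
have w0 : 0 <= w.
  rewrite mulr_ge0 ?invr_ge0// mulr_ge0 ?sqr_ge0// mulr_ge0//.
  by rewrite subr_ge0 invf_le1 ?ltr0n// ler1n.
have rv : r%:R * v = sigma ^+ 2 / r%:R by rewrite /v; field.
have rv0 : 0 < r%:R * v by rewrite mulr_gt0.
have htau : 7 * (w + r%:R * v) <= tau by rewrite rv; exact: sigma2_rM_ge.
have GE (t : r.-tuple Xi) : batch_mean g x t - mu = 0 + \sum_(i < r) Y (tnth t i).
  rewrite add0r -scaler_sumr sumrB sumr_const card_ord scalerBr; congr (_ - _).
  by rewrite -[X in _ *: X]scaler_nat scalerA mulVf// scale1r.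
have GB (t : r.-tuple Xi) : norm1 (batch_mean g x t) <= B.
  apply: (@le_trans _ _ (r%:R^-1 * \sum_(i < r) norm1 (g x (tnth t i)))).
    rewrite /norm1 exchange_big mulr_sumr; apply: ler_sum => j _.
    rewrite mxE normrM ger0_norm ?invr_ge0// ler_pM2l ?invr_gt0// summxE.
    exact: ler_norm_sum.
  rewrite ler_pdivrMl//; apply: (@le_trans _ _ (\sum_(i < r) B)).
    by apply: ler_sum => i _.
  by rewrite sumr_const card_ord mulr_natl.
have ig j : P.-integrable setT (fun xi => (g x xi 0 j)%:E).
  apply: measurable_bounded_integrable => //.
    by rewrite (le_lt_trans (probability_le1 _ _)) ?ltry.
  exists B; split; first exact: num_real.
  move=> c Bc xi _ /=; apply: (le_trans _ (ltW Bc)); apply: (le_trans _ (hB x xi)).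
  by rewrite /norm1 (bigD1 j)//= lerDl sumr_ge0.
have YE xi j : (Y xi 0 j)%:E = (r%:R^-1%:E * ((g x xi 0 j)%:E - (mu 0 j)%:E))%E.
  by rewrite !mxE.
have ic j : P.-integrable setT (fun=> (mu 0 j)%:E).
  exact: finite_measure_integrable_cst.
have iY j : P.-integrable setT (fun xi => (Y xi 0 j)%:E).
  under eq_fun do rewrite YE.
  by apply: integrableZl => //; exact: integrableB.
have EY j : (\int[P]_xi (Y xi 0 j)%:E = 0)%E.
  under eq_integral do rewrite YE.
  rewrite integralZl//; last exact: integrableB.
  rewrite integralB// integral_cst//.
  rewrite [X in ((mu 0 j)%:E * X)%E](_ : _ = 1%E); last exact: probability_setT.
  by have := hmean x j; rewrite unlock => ->; rewrite mule1 subee// mule0.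
have expY : (\int[P]_xi (expR (norm2 (Y xi) ^+ 2 / v))%:E <= (expR 1)%:E)%E.
  have := htail x; rewrite unlock; apply: le_trans.
  rewrite le_eqVlt; apply/orP; left; apply/eqP; apply: eq_integral => xi _.
  rewrite norm2_sqrZ /v; congr (expR _)%:E; field.
  by rewrite r0 gt_eqF.
set tau' := tau - 6 * w.
have htau' : 6 * (r%:R * v) < tau' by rewrite /tau'; lra.
(* Quantization, conditionally on the batch, lowers the level to tau'. *)
apply: (@le_trans _ _ (\int[iid P r]_t ((expR (w / tau'))%:E *
    (expR (norm2 (0 + \sum_(i < r) Y (tnth t i)) ^+ 2 / tau'))%:E))%E).
  apply: ge0_le_integralT => t.
    rewrite lee_fin; apply: sumr_ge0 => k _; rewrite mulr_ge0//.
      by apply: prodr_ge0 => i _; exact: pps_weight_ge0.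
    apply: sumr_ge0 => l _; rewrite mulr_ge0 ?expR_ge0//.
    by apply: prodr_ge0 => i _; exact: pps_weight_ge0.
  rewrite -EFinM lee_fin -expRD -mulrDl -GE.
  by apply: pps_cond_expect_le => //; rewrite -/w; lra.
rewrite ge0_integralZl//; last first.
  apply: measurable_expR_norm2 => j; under eq_fun do rewrite mxE summxE.
  apply: measurable_funD => //; apply: measurable_sum => i.
  have /measurable_int/measurable_EFinP mYj := iY j.
  exact: (measurableT_comp mYj (measurable_tnth i)).
apply: (le_trans (lee_wpmul2l _ (subgaussian_walk v0 iY EY expY 0 htau'))).
  by rewrite lee_fin expR_ge0.
rewrite -EFinM -expRD lee_fin ler_expR.
apply: (le_trans (walk_exponentD _ w0 (ltW rv0) htau')).
have -> : norm2 (0 : 'rV[R]_n) ^+ 2 = 0.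
  by rewrite norm2_sqr /dot big1// => j _; rewrite mxE mulr0.
by rewrite addr0 ler_pdivrMr /tau'; lra.
Qed.
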